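(* (i) If $\Lambda$ is not contained in a real line, and $U\subseteq D$ is an open set with $-1\in\overline{U}$, then for generic $\bm{\lambda}=(\lambda_n)_{n=0}^{\infty}\in\Omega$, the image $f_{\bm{\lambda}}(U)$ is a dense and open subset of $\mathbb{C}$. (ii) If $\Lambda$ is contained in a real line, then there exist an open set $U\subseteq D$ with $-1\in\overline{U}$ and a closed real half-plane $H\subseteq\mathbb{C}$ such that $f_{\bm{\lambda}}(U)\cap H=\emptyset$ for every $\bm{\lambda}\in\Omega$.
   Context: $D=\{z\in\mathbb{C}:|z|<1\}$ is the open unit disk; $\overline{B}$ denotes the closure of $B\subseteq\mathbb{C}$. $\Lambda\subseteq\mathbb{C}$ is a bounded set with at least two elements, endowed with the subspace topology, and $\Omega=\Omega_\Lambda:=\prod_{n=0}^{\infty}\Lambda$ carries the product topology; it is assumed throughout that $\Omega$ is a Baire space. For $\bm{\lambda}=(\lambda_n)_{n=0}^\infty\in\Omega$, $f_{\bm{\lambda}}(z):=\sum_{n=0}^\infty\lambda_n z^n$, which is holomorphic in $D$. A property holds ''for generic $\bm{\lambda}\in\Omega$'' if the set of $\bm{\lambda}\in\Omega$ for which it holds is residual (its complement is meager) in $\Omega$. A real line is a one-dimensional real affine subspace of $\mathbb{C}$; a real half-plane is one of the two components of the complement of a real line, and its closure is called a closed real half-plane. *)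

(* Defs.v *)
From HB Require Import structures.
From mathcomp Require Import all_boot all_order all_algebra.
From mathcomp Require Import complex.
From mathcomp Require Import all_classical all_reals all_analysis.

Set Implicit Arguments.
Unset Strict Implicit.
Unset Printing Implicit Defensive.

Import Order.TTheory GRing.Theory Num.Theory.
Import numFieldNormedType.Exports.

Local Open Scope classical_set_scope.
Local Open Scope complex_scope.
Local Open Scope ring_scope.

(* R[i] is given the topology of its modulus.  Its norm is R[i]-valued: the
   modulus as a real element of R[i]; its order compares only numbers with
   equal imaginary parts, so [`|z| < 1] is the usual inequality. *)
HB.instance Definition _ (R : realType) := NormedModule.copy R[i] R[i]^o.

Section Category.
Variable T : topologicalType.
Implicit Type A : set T.

Definition nowhere_dense A := interior (closure A) = set0.

Definition meager A :=
  exists2 F : nat -> set T,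
    (forall n, nowhere_dense (F n)) & A = \bigcup_n F n.

Definition residual A := meager (~` A).

Definition generically (P : T -> Prop) := residual [set x | P x].

Definition baire_space :=
  forall F : nat -> set T,
    (forall n, open (F n) /\ dense (F n)) -> dense (\bigcap_n F n).

End Category.

Arguments baire_space T : clear implicits.

Section Plane.
Variable R : realType.

Definition unit_disk : set R[i] := [set z | `|z| < 1].

Definition real_line (L : set R[i]) :=
  exists a b : R[i], b != 0 /\ L = [set a + t%:C * b | t in [set: R]].

Definition real_half_plane (P : set R[i]) :=
  exists (L : set R[i]) (z : R[i]),
    [/\ real_line L, ~ L z & P = connected_component (~` L) z].

Definition closed_real_half_plane (H : set R[i]) :=
  exists2 P : set R[i], real_half_plane P & H = closure P.

(* [L] coerces to the sigma type of its elements, whose topology is the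
   subspace topology. *)
Definition Omega (L : set R[i]) := prod_topology (fun _ : nat => L : Type).

HB.instance Definition _ (L : set R[i]) := Topological.copy (Omega L)
  (prod_topology (fun _ : nat => L : Type)).

Definition power_series (L : set R[i]) (lambda : Omega L) (z : R[i]) : R[i] :=
  limn (series (fun n : nat => set_val (lambda n) * z ^+ n)).

End Plane.

(* Main.v *)
Require Import Defs.
From HB Require Import structures.
From mathcomp Require Import all_boot all_order all_algebra.
From mathcomp Require Import complex.
From mathcomp Require Import all_classical all_reals all_analysis.
From mathcomp Require Import ring lra.

Set Implicit Arguments.
Unset Strict Implicit.
Unset Printing Implicit Defensive.

Import Order.TTheory GRing.Theory Num.Theory.
Import numFieldNormedType.Exports.
Import Normc.

Local Open Scope classical_set_scope.
Local Open Scope complex_scope.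
Local Open Scope ring_scope.

(** Why the theorem holds.

    Suppose first that [Lambda] spans no line.  Fix a target [w], a prefix
    [lambda_0, ..., lambda_(N-1)], and a point [z] of the disc close to [-1].
    The remaining coefficients must satisfy
    [sum_n lambda_(N+n) z ^ n = (w - prefix) / z ^ N], whose right-hand side
    stays in a fixed disc as [z] tends to [-1].  Such a value can be expanded
    digit by digit in base [z].  Two digits [l], [l'] contribute [l + z l'],
    nearly the difference [l - l'], and since [Lambda] is not collinear these
    differences have a definite component in every direction
    ([noncollinear_directions]); so a remainder [x] in a large disc can be
    moved so far into it that dividing by [z ^ 2] does not lead out of the disc
    again ([two_digit_step]).  The argument of [z] does not matter because
    discs are invariant under rotations, which is why [U] may approach [-1] in
    any manner.  Hence [w] is attained exactly, with any prefix, at points of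
    [U] ([psum_attains], [dense_attains]).  As [f z] depends continuously on
    the coefficients, the sequences whose image of [U] meets a given disc form
    a dense open set, and letting the disc run through a countable base
    shows that the image is dense for generic coefficients
    ([generically_dense]).

    A dense image is not a point, so density brings a nonconstant series, and
    openness is the open mapping theorem ([psum_open_mapping]).  It is proved
    here for power series with bounded coefficients, a class closed under
    division by [z - z1] ([psum_quot]): repeated division gives the local form
    [f z1 + (z - z1) ^ k * g z] with [g z1 <> 0], once the identity theorem
    ([psum_identity]) has excluded infinite order.  The open mapping theorem
    then follows from the minimum of [|f - w|] over a closed disc, which cannot
    be positive in the interior ([psum_decrease]).

    Suppose now that [Lambda] lies on the line [p + R b].  Then [f / b] is
    [(p / b) / (1 - z)], bounded near [-1], plus a series with bounded real
    coefficients, and the imaginary part of the latter is bounded where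
    [|Im z| <= (1 - |z|) ^ 2], because there the sum of the [|Im (z ^ n)|] is at
    most [1] ([sum_Im_expr]).  An open set with [-1] in its closure fits into
    this region ([cusp]), so on it every [f] satisfies the same upper bound
    on [Im (f / b)] and misses a half-plane. *)

(** * The real-valued modulus and the topology it induces *)

Section Modulus.
Variable R : rcfType.
Implicit Types x y z : R[i].

Lemma norm_normc z : `|z| = (normc z)%:C.
Proof. by case: z. Qed.

Lemma normc_ge0 z : 0 <= normc z.
Proof. by case: z => a b; rewrite sqrtr_ge0. Qed.

Lemma normc_leD x y : normc (x + y) <= normc x + normc y.
Proof. exact: le_normcD. Qed.

Lemma normc_opp x : normc (- x) = normc x.
Proof. exact: normcN. Qed.

Lemma normcBC x y : normc (x - y) = normc (y - x).
Proof. by rewrite -normc_opp opprB. Qed.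

Lemma normc_subD x y : normc (x - y) <= normc x + normc y.
Proof. by rewrite -(normc_opp y) normc_leD. Qed.

Lemma normc_leB x y : normc x - normc y <= normc (x - y).
Proof. by rewrite lerBlDr -{1}(subrK y x) normc_leD. Qed.

Lemma normc_dist_triangle y x z :
  normc (x - z) <= normc (x - y) + normc (y - z).
Proof. by have := normc_leD (x - y) (y - z); rewrite addrA subrK. Qed.

Lemma normcX x n : normc (x ^+ n) = normc x ^+ n.
Proof.
by elim: n => [|n IH]; rewrite ?expr0 ?(@normc1 R)// !exprS normcM IH.
Qed.

Lemma normc_real (t : R) : normc t%:C = `|t|.
Proof. by rewrite /normc /= expr0n /= addr0 sqrtr_sqr. Qed.

Lemma normc_eq0 x : (normc x == 0) = (x == 0).
Proof.
by apply/eqP/eqP => [|->]; [exact: eq0_normc | exact: (@normc0 R)].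
Qed.

Lemma normc_gt0 x : (0 < normc x) = (x != 0).
Proof. by rewrite lt_neqAle normc_ge0 andbT eq_sym normc_eq0. Qed.

Lemma normc_sum (n : nat) (F : 'I_n -> R[i]) :
  normc (\sum_(i < n) F i) <= \sum_(i < n) normc (F i).
Proof.
elim/big_ind2: _ => [|x1 x2 y1 y2 h1 h2|//]; first by rewrite (@normc0 R).
by rewrite (le_trans (normc_leD _ _))// lerD.
Qed.

Lemma ler_norm_hypot (a b : R) : `|a| <= Num.sqrt (a ^+ 2 + b ^+ 2).
Proof. by rewrite -sqrtr_sqr ler_sqrt ?addr_ge0 ?sqr_ge0// lerDl sqr_ge0. Qed.

Lemma Re_normc x : `|complex.Re x| <= normc x.
Proof. by case: x => a b; exact: ler_norm_hypot. Qed.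

Lemma Im_normc x : `|complex.Im x| <= normc x.
Proof. by case: x => a b; rewrite /normc addrC; exact: ler_norm_hypot. Qed.

Lemma normc_ReIm x : normc x <= `|complex.Re x| + `|complex.Im x|.
Proof.
rewrite [in leLHS](complexE x); apply: le_trans (normc_leD _ _) _.
by rewrite normcM !normc_real lerD2l /normc expr0n add0r expr1n sqrtr1 mul1r.
Qed.

End Modulus.

Section ModulusTopology.
Variable R : realType.
Implicit Types x y z : R[i].

Lemma nbhs_normc z (A : set R[i]) :
  nbhs z A <-> exists2 e : R, 0 < e & forall y, normc (y - z) < e -> A y.
Proof.
rewrite -nbhs_nbhs_norm; split=> [[e /= e0 H]|[e e0 H]].
  have er : e = (complex.Re e)%:C by rewrite RRe_real// gtr0_real.
  exists (complex.Re e); first by move: e0; rewrite er ltcR.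
  by move=> y yz; apply: H; rewrite /ball_ /= norm_normc er ltcR normcBC.
exists e%:C; first by rewrite /= ltcR.
by move=> y; rewrite /ball_ /= norm_normc ltcR normcBC; exact: H.
Qed.

Lemma unit_diskE z : @unit_disk R z = (normc z < 1) :> Prop.
Proof. by rewrite /unit_disk /= norm_normc -[1]/(1%:C) ltcR. Qed.

Lemma open_normcP (A : set R[i]) : open A <->
  forall z, A z -> exists2 e : R, 0 < e & forall y, normc (y - z) < e -> A y.
Proof.
rewrite openE; split=> H z Az.
  by have /nbhs_normc := H z Az.
by apply/nbhs_normc; exact: H.
Qed.

Lemma closure_normcP (A : set R[i]) z : closure A z <->
  forall e : R, 0 < e -> exists2 y, A y & normc (y - z) < e.
Proof.
split=> [cA e e0|H B /nbhs_normc[e e0 HB]].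
  have /cA[y [Ay ye]] : nbhs z [set y | normc (y - z) < e].
    by apply/nbhs_normc; exists e.
  by exists y.
by have [y Ay /HB By] := H _ e0; exists y.
Qed.

(** Boundedness in [R[i]] is stated with [R[i]]-valued bounds; only their real
    parts matter. *)
Lemma bounded_setC (A : set R[i]) : bounded_set A ->
  exists2 M : R, 0 <= M & forall x, A x -> normc x <= M.
Proof.
move=> [N [_ /(_ (N + 1))]]; rewrite ltrDl ltr01 => /(_ isT) /= HN.
exists (`|complex.Re (N + 1)|) => // x /HN.
rewrite norm_normc lecE /= => /andP[_ h].
by rewrite (le_trans h)// ler_norm.
Qed.

Lemma le0_geometric (x C r : R) : 0 <= r -> r < 1 ->
  (forall n, x <= C * r ^+ n) -> x <= 0.
Proof.
move=> r0 r1 H; have r1' : `|r| < 1 by rewrite ger0_norm.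
have cg := cvg_geometric C r1'.
rewrite -(cvg_lim _ cg)//; apply: limr_ge; first by apply/cvg_ex; exists 0.
by apply: nearW => n; exact: H.
Qed.

Lemma eq_geometric (x y : R[i]) (C r : R) : 0 <= r -> r < 1 ->
  (forall n, normc (x - y) <= C * r ^+ n) -> x = y.
Proof.
move=> r0 r1 /(le0_geometric r0 r1) h; apply/eqP; rewrite -subr_eq0 -normc_eq0.
by rewrite eq_le h normc_ge0.
Qed.

End ModulusTopology.

(** * Power series with bounded coefficients *)

(** Locked: unfolding the limit is never useful when two sums are compared up
    to conversion. *)
HB.lock Definition psum (R : realType) (a : nat -> R[i]) (z : R[i]) : R[i] :=
  limn (series (fun n => a n * z ^+ n)).

Section PowerSeries.
Variable R : realType.
Implicit Types (a : nat -> R[i]) (M : R) (z s : R[i]).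

Definition psumn a z N : R[i] := \sum_(n < N) a n * z ^+ n.

Definition shift (k : nat) a : nat -> R[i] := fun n => a (k + n)%N.

Definition coef_le a M := forall n, normc (a n) <= M.

Lemma coef_le_ge0 a M : coef_le a M -> 0 <= M.
Proof. by move=> aM; apply: le_trans (aM 0); exact: normc_ge0. Qed.

Lemma coef_le_shift k a M : coef_le a M -> coef_le (shift k a) M.
Proof. by move=> aM n; exact: aM. Qed.

Lemma psumn_recl a z N : psumn a z N.+1 = a 0 + z * psumn (shift 1 a) z N.
Proof.
rewrite /psumn big_ord_recl expr0 mulr1; congr (_ + _).
rewrite mulr_sumr; apply: eq_bigr => n _.
by rewrite /shift /bump /= exprS mulrCA.
Qed.

Lemma psumn_recr a z N : psumn a z N.+1 = psumn a z N + a N * z ^+ N.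
Proof. by rewrite /psumn big_ord_recr. Qed.

Lemma psumn_le a M z N : coef_le a M -> normc z < 1 ->
  normc (psumn a z N) <= M / (1 - normc z).
Proof.
move=> aM z1; have M0 := coef_le_ge0 aM; have r0 := normc_ge0 z.
rewrite ler_pdivlMr ?subr_gt0//; elim: N a aM => [|N IH] a aM.
  by rewrite /psumn big_ord0 (@normc0 R) mul0r.
rewrite psumn_recl; have := IH _ (coef_le_shift 1 aM).
have := normc_leD (a 0) (z * psumn (shift 1 a) z N); rewrite normcM.
have := aM 0; set u := normc (_ + _); set v := normc (psumn _ _ _).
by nra.
Qed.

Lemma psum_cvg a M z : coef_le a M -> normc z < 1 -> forall e : R, 0 < e ->
  exists N, forall n, (N <= n)%N -> normc (psumn a z n - psum a z) < e.
Proof.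
move=> aM z1.
have r1 : `|normc z| < 1 by rewrite ger0_norm ?normc_ge0.
have cvp (p : R[i] -> R) : (forall x, `|p x| <= normc x) ->
    cvgn (series (fun n => p (a n * z ^+ n))).
  move=> pn; apply: normed_cvg.
  apply: series_le_cvg (is_cvg_geometric_series (a := M) r1).
  - by move=> n /=.
  - by move=> n; rewrite mulr_ge0 ?(coef_le_ge0 aM)// exprn_ge0// normc_ge0.
  - move=> n; apply: le_trans (pn _) _.
    by rewrite normcM normcX ler_wpM2r// exprn_ge0// normc_ge0.
have /cvg_ex[x cx] := cvp _ (@Re_normc R).
have /cvg_ex[y cy] := cvp _ (@Im_normc R).
have serE n : series (fun n => a n * z ^+ n) n = psumn a z n.
  by rewrite /series /= big_mkord.
have E n : psumn a z n =
    (series (fun n => complex.Re (a n * z ^+ n)) n) +i*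
    (series (fun n => complex.Im (a n * z ^+ n)) n).
  rewrite /series /= !big_mkord /psumn.
  apply/eqP; rewrite eq_complex /= !raddf_sum; apply/andP; split; exact/eqP.
have H e : 0 < e -> exists N, forall n, (N <= n)%N ->
    normc (psumn a z n - (x +i* y)) < e.
  move=> e0; have e20 : 0 < e / 2 by rewrite divr_gt0.
  have /cvgrPdist_lt/(_ _ e20)[N1 _ h1] := cx.
  have /cvgrPdist_lt/(_ _ e20)[N2 _ h2] := cy.
  exists (maxn N1 N2) => n; rewrite geq_max => /andP[n1 n2].
  apply: le_lt_trans (normc_ReIm _) _; rewrite E /=.
  have := h1 n n1; have := h2 n n2; rewrite /= distrC => k2; rewrite distrC => k1.
  by rewrite [ltRHS]splitr ltrD.
suff -> : psum a z = x +i* y by [].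
rewrite psum.unlock; apply: cvg_lim; first exact: norm_hausdorff.
move=> A /nbhs_normc[e e0 HA]; have [N HN] := H e e0.
by exists N => // n /= /HN; rewrite -serE => /HA.
Qed.

Lemma psum_le a M z : coef_le a M -> normc z < 1 ->
  normc (psum a z) <= M / (1 - normc z).
Proof.
move=> aM z1; apply/ler_addgt0Pl => e e0.
have [N /(_ N (leqnn _)) /ltW h] := psum_cvg aM z1 e0.
have := psumn_le N aM z1; have := normc_leB (psum a z) (psumn a z N).
rewrite normcBC; lra.
Qed.

Lemma psum_recl a M z : coef_le a M -> normc z < 1 ->
  psum a z = a 0 + z * psum (shift 1 a) z.
Proof.
move=> aM z1; apply/eqP; rewrite -subr_eq0 -normc_eq0 eq_le normc_ge0 andbT.
apply/ler_addgt0Pl => e e0; rewrite addr0.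
have e20 : 0 < e / 2 by rewrite divr_gt0.
have [N1 h1] := psum_cvg aM z1 e20.
have [N2 h2] := psum_cvg (coef_le_shift 1 aM) z1 e20.
set N := maxn N1 N2; have {}h1 := h1 N.+1 (leqW (leq_maxl _ _)).
have {}h2 := h2 N (leq_maxr _ _).
have -> : psum a z - (a 0 + z * psum (shift 1 a) z) =
    z * (psumn (shift 1 a) z N - psum (shift 1 a) z)
    - (psumn a z N.+1 - psum a z) by rewrite psumn_recl; ring.
apply: le_trans (normc_subD _ _) _; rewrite normcM.
have := normc_ge0 z; set u := normc z in z1 *; move: h1 h2.
have := normc_ge0 (psumn (shift 1 a) z N - psum (shift 1 a) z).
set v := normc _; set w := normc _; nra.
Qed.

Lemma psum_shift a M z N : coef_le a M -> normc z < 1 ->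
  psum a z = psumn a z N + z ^+ N * psum (shift N a) z.
Proof.
move=> aM z1; elim: N => [|N ->]; first by rewrite /psumn big_ord0 add0r mul1r.
rewrite psumn_recr (psum_recl (coef_le_shift N aM) z1).
rewrite /shift addn0 exprSr; under [in RHS]eq_fun do rewrite addSnnS.
by ring.
Qed.

(** The way every identity between power series is obtained below: a number
    that all partial sums approximate geometrically is the sum. *)
Lemma psum_unique a M C z s : coef_le a M -> normc z < 1 ->
  (forall n, normc (s - psumn a z n) <= C * normc z ^+ n) -> psum a z = s.
Proof.
move=> aM z1 H; apply/esym.
apply: (@eq_geometric _ _ _ (C + M / (1 - normc z)) (normc z)) => //.
  exact: normc_ge0.
move=> n; rewrite (psum_shift n aM z1) opprD addrA mulrDl.
apply: le_trans (normc_subD _ _) _; rewrite lerD// normcM normcX mulrC.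
rewrite ler_wpM2r ?exprn_ge0 ?normc_ge0//.
exact: psum_le (coef_le_shift n aM) z1.
Qed.

(** Synthetic division by [z - z1]: these are the coefficients of
    [(f z - f z1) / (z - z1)], where [f = psum a]. *)
Definition quot (z1 : R[i]) a : nat -> R[i] :=
  fun n => psum (shift n.+1 a) z1.

Lemma coef_le_quot z1 a M : coef_le a M -> normc z1 < 1 ->
  coef_le (quot z1 a) (M / (1 - normc z1)).
Proof. by move=> aM h1 n; exact: psum_le (coef_le_shift _ aM) h1. Qed.

(** Power series with bounded coefficients are closed under division by
    [z - z1]; iterating this replaces Taylor expansions at [z1]. *)
Lemma psum_quot z1 a M z : coef_le a M -> normc z1 < 1 -> normc z < 1 ->
  psum a z = psum a z1 + (z - z1) * psum (quot z1 a) z.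
Proof.
move=> aM h1 hz; set q := quot z1 a; pose t n := psum (shift n a) z1.
have tE n : t n = a n + z1 * t n.+1.
  rewrite /t (psum_recl (coef_le_shift n aM) h1) /shift addn0.
  by under [in RHS]eq_fun do rewrite addSnnS.
have qE N : (z - z1) * psumn q z N = psumn a z N - psum a z1 + z ^+ N * t N.
  elim: N => [|N IH]; first by rewrite /psumn !big_ord0 /t expr0; ring.
  by rewrite !psumn_recr mulrDr IH (tE N) /q /quot -/(t N.+1) exprS; ring.
have qM := coef_le_quot aM h1; set M' := M / _ in qM.
apply: (@psum_unique _ M (normc (z - z1) * (M' / (1 - normc z)) + M')) => // n.
have -> : psum a z1 + (z - z1) * psum q z - psumn a z n =
    z ^+ n * ((z - z1) * psum (shift n q) z + t n).
  by rewrite (psum_shift n qM hz) mulrDr qE; ring.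
rewrite normcM normcX mulrC ler_wpM2r ?exprn_ge0 ?normc_ge0//.
apply: le_trans (normc_leD _ _) _; rewrite lerD//.
  rewrite normcM ler_wpM2l ?normc_ge0//.
  exact: psum_le (coef_le_shift _ qM) hz.
exact: psum_le (coef_le_shift _ aM) h1.
Qed.

Lemma psum_continuous a M z1 (e : R) : coef_le a M -> normc z1 < 1 -> 0 < e ->
  exists2 d : R, 0 < d & forall z, normc (z - z1) < d ->
    normc z < 1 /\ normc (psum a z - psum a z1) < e.
Proof.
move=> aM h1 e0; have M0 := coef_le_ge0 aM.
pose u := 1 - normc z1; have u0 : 0 < u by rewrite subr_gt0.
pose K := M / u / (u / 2).
have K0 : 0 <= K by rewrite !divr_ge0 // ltW.
exists (Num.min (u / 2) (e / (K + 1))).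
  by rewrite lt_min !divr_gt0// ltr_wpDl.
move=> z; rewrite lt_min => /andP[zu ze].
have zz : normc z < 1 - u / 2.
  by have := normc_leB z z1; rewrite /u in zu *; lra.
have z1' : normc z < 1 by lra.
split=> //; rewrite (psum_quot aM h1 z1') addrAC subrr add0r normcM.
have : normc (psum (quot z1 a) z) <= K.
  apply: le_trans (psum_le (coef_le_quot aM h1) z1') _.
  by rewrite /K ler_wpM2l ?(divr_ge0 M0 (ltW u0))// lef_pV2 ?posrE; lra.
move: ze; rewrite ltr_pdivlMr; last lra.
have := normc_ge0 (z - z1); set v := normc _; set w := normc _; nra.
Qed.

End PowerSeries.

(** * The identity theorem and the local form of a power series *)

Section IdentityTheorem.
Variable R : realType.
Implicit Types (a g : nat -> R[i]) (M : R) (z w : R[i]).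

Lemma coef_le_iter_quot k z1 a M : coef_le a M -> normc z1 < 1 ->
  coef_le (iter k (quot z1) a) (M / (1 - normc z1) ^+ k).
Proof.
move=> aM h1; elim: k => [|k IH] /=; first by rewrite divr1.
by rewrite exprSr invfM mulrA; exact: coef_le_quot.
Qed.

Lemma psum_iter_quot k z1 a M z : coef_le a M -> normc z1 < 1 ->
  normc z < 1 -> (forall j, (j < k)%N -> psum (iter j (quot z1) a) z1 = 0) ->
  psum a z = (z - z1) ^+ k * psum (iter k (quot z1) a) z.
Proof.
move=> aM h1 hz; elim: k => [|k IH] H; first by rewrite mul1r.
rewrite IH => [|j jk]; last exact/H/ltnW.
rewrite (psum_quot (coef_le_iter_quot k aM h1) h1 hz) H// add0r.
by rewrite mulrA -exprSr.
Qed.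

(** Vanishing to infinite order at [z1]: the values are those of the iterated
    quotients, which play the part of Taylor coefficients. *)
Definition flat a z1 := forall k, psum (iter k (quot z1) a) z1 = 0.

Definition near_zero a z1 :=
  exists2 d : R, 0 < d & forall z, normc (z - z1) < d -> psum a z = 0.

Lemma not_flat_factor a M z1 : coef_le a M -> normc z1 < 1 -> ~ flat a z1 ->
  exists k g M', [/\ coef_le g M', psum g z1 != 0 &
    forall z, normc z < 1 -> psum a z = (z - z1) ^+ k * psum g z].
Proof.
move=> aM h1 /existsNP[k0 hk0].
have ex : exists k, psum (iter k (quot z1) a) z1 != 0 by exists k0; exact/eqP.
case: (ex_minnP ex) => k hk kmin.
exists k, (iter k (quot z1) a), (M / (1 - normc z1) ^+ k); split=> //.
  exact: coef_le_iter_quot.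
move=> z hz; apply: (psum_iter_quot aM) => // j jk; apply/eqP/negPn/negP => hj.
by have := kmin _ hj; rewrite leqNgt jk.
Qed.

(** The [k]-th quotient grows at most like [(1 - |z1|) ^- k], so the factor
    [(z - z1) ^+ k] wins inside this disc. *)
Lemma flat_disc a M z1 z : coef_le a M -> normc z1 < 1 -> flat a z1 ->
  normc z < 1 -> normc (z - z1) < 1 - normc z1 -> psum a z = 0.
Proof.
move=> aM h1 fl hz hd; have u0 : 0 < 1 - normc z1 by rewrite subr_gt0.
apply: (@eq_geometric _ _ _ (M / (1 - normc z))
  (normc (z - z1) / (1 - normc z1))).
- by rewrite divr_ge0 ?normc_ge0// ltW.
- by rewrite ltr_pdivrMr// mul1r.
move=> k; rewrite subr0 (psum_iter_quot (k := k) aM h1 hz)// normcM normcX.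
rewrite expr_div_n.
have := psum_le (coef_le_iter_quot k aM h1) hz.
move=> /(ler_wpM2l (exprn_ge0 k (normc_ge0 (z - z1)))) h.
apply: le_trans h _; rewrite le_eqVlt; apply/orP; left; apply/eqP.
set p := (_ ^+ k); set q := (_ ^+ k); set s := 1 - _; ring.
Qed.

(** At a zero of finite order the factor [g] is nonzero nearby, so the zero
    is isolated. *)
Lemma near_zero_flat a M z1 : coef_le a M -> normc z1 < 1 ->
  near_zero a z1 -> flat a z1.
Proof.
move=> aM h1 [d d0 H]; apply: contrapT => nfl.
have [k [g [M' [gM g1 E]]]] := not_flat_factor aM h1 nfl.
have g10 : 0 < normc (psum g z1) by rewrite normc_gt0.
have [d' d'0 H'] := psum_continuous gM h1 g10.
pose t := Num.min d d' / 2; have t0 : 0 < t by rewrite divr_gt0// lt_min d0.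
pose z := z1 + t%:C.
have zz : z - z1 = t%:C by rewrite /z addrC addKr.
have nz : normc (z - z1) = t by rewrite zz normc_real gtr0_norm.
have tm : t < Num.min d d' by rewrite /t ltr_pdivrMr// ltr_pMr ?lt_min ?d0// ltr1n.
move: tm; rewrite lt_min => /andP[td td'].
have [] := H' z; first by rewrite nz.
move=> hz; have := E z hz; rewrite H ?nz//.
move=> /esym/eqP; rewrite mulf_eq0 expf_eq0 -normc_eq0 nz (gt_eqF t0) andbF /=.
move=> /eqP ->; rewrite sub0r normc_opp ltxx //.
Qed.

Lemma near_zero_move a M z1 z2 : coef_le a M -> normc z1 < 1 ->
  near_zero a z1 -> normc (z2 - z1) < 1 - normc z1 -> near_zero a z2.
Proof.
move=> aM h1 /(near_zero_flat aM h1) fl h.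
exists (1 - normc z1 - normc (z2 - z1)); first by rewrite subr_gt0.
move=> z hz; have := normc_dist_triangle z2 z z1; have := normc_leB z z1 => *.
by apply: (flat_disc aM h1 fl); lra.
Qed.

(** Vanishing spreads from [z1] to the origin along the segment in steps
    shorter than [1 - |z1|]; at the origin, [k]-fold division exhibits the
    [k]-th coefficient. *)
Theorem psum_identity a M z1 : coef_le a M -> normc z1 < 1 ->
  near_zero a z1 -> forall n, a n = 0.
Proof.
move=> aM h1 nz1.
have u0 : 0 < 1 - normc z1 by rewrite subr_gt0.
pose N := Num.trunc (1 - normc z1)^-1.
have hN : N.+1%:R^-1 < 1 - normc z1.
  rewrite -[ltRHS]invrK ltf_pV2 ?posrE ?invr_gt0// ?ltr0n//.
  exact: truncnS_gt.
pose pt (k : nat) : R[i] := (1 - k%:R / N.+1%:R : R)%:C * z1.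
have steps k : (k <= N.+1)%N -> near_zero a (pt k).
  elim: k => [_|k IH kN]; first by rewrite /pt mul0r subr0 mul1r.
  have kN1 : (k%:R / N.+1%:R : R) <= 1.
    by rewrite ler_pdivrMr ?ltr0n// mul1r ler_nat ltnW.
  have k0 : 0 <= (k%:R / N.+1%:R : R) by rewrite divr_ge0.
  have npt : normc (pt k) <= normc z1.
    rewrite /pt normcM normc_real ger0_norm ?subr_ge0//.
    by rewrite ler_piMl ?normc_ge0// gerBl.
  apply: near_zero_move (IH (ltnW kN)) _ => //; first exact: le_lt_trans h1.
  rewrite /pt -mulrBl normcM -rmorphB normc_real.
  have -> : (1 - k.+1%:R / N.+1%:R - (1 - k%:R / N.+1%:R) : R) = - N.+1%:R^-1.
    by rewrite -[k.+1%:R]natr1; ring.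
  rewrite normrN ger0_norm ?invr_ge0//.
  apply: le_lt_trans (_ : _ <= N.+1%:R^-1) _.
    by rewrite ler_piMr ?invr_ge0// ltW.
  by apply: lt_le_trans hN _; rewrite lerD2l lerN2.
have n0 : normc (0 : R[i]) < 1 by rewrite (@normc0 R) ltr01.
have := steps _ (leqnn N.+1); rewrite /pt divff ?pnatr_eq0// subrr mul0r.
move=> /(near_zero_flat aM n0) fl.
have p0 b M' : coef_le b M' -> psum b 0 = b 0.
  by move=> bM; rewrite (psum_recl bM n0) mul0r addr0.
have qE k n : iter k (quot 0) a n = a (k + n)%N.
  elim: k n => [//|k IH] n /=; rewrite /quot.
  rewrite (p0 _ _ (coef_le_shift n.+1 (coef_le_iter_quot k aM n0))).
  by rewrite /shift IH addn0 addnS.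
by move=> n; have := fl n; rewrite (p0 _ _ (coef_le_iter_quot _ aM n0)) qE addn0.
Qed.

(** The constant coefficient does not enter [quot z1 a], so the identity
    theorem applies to the quotient: if it vanished, the recurrence between
    its coefficients would give [a n.+1 = 0]. *)
Lemma psum_local_form a M z1 : coef_le a M -> normc z1 < 1 ->
  (exists n, a n.+1 != 0) ->
  exists k g M', [/\ coef_le g M', psum g z1 != 0 &
    forall z, normc z < 1 ->
      psum a z = psum a z1 + (z - z1) ^+ k.+1 * psum g z].
Proof.
move=> aM h1 [n an]; have qM := coef_le_quot aM h1.
have nfl : ~ flat (quot z1 a) z1.
  move=> fl; have nz : near_zero (quot z1 a) z1.
    exists (1 - normc z1) => [|z hz]; first by rewrite subr_gt0.
    apply: (flat_disc qM h1 fl) => //.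
    by have := normc_leB z z1; lra.
  have q0 := psum_identity qM h1 nz.
  move: an; have := q0 n; rewrite /quot (psum_recl (coef_le_shift _ aM) h1).
  rewrite /shift addn0; under [X in psum X]eq_fun do rewrite addnA addn1.
  by have := q0 n.+1; rewrite /quot => ->; rewrite mulr0 addr0 => ->; rewrite eqxx.
have [k [g [M' [gM g1 E]]]] := not_flat_factor qM h1 nfl.
exists k, g, M'; split=> // z hz.
by rewrite (psum_quot aM h1 hz) (E z hz) mulrA -exprS.
Qed.

End IdentityTheorem.

(** * The open mapping theorem *)

Section OpenMapping.
Variable R : realType.
Implicit Types (a g : nat -> R[i]) (M : R) (z w : R[i]).

Lemma closed_disc_compact z0 (r : R) :
  compact [set z : R[i] | normc (z - z0) <= r].
Proof.
pose f (p : R * R) : R[i] := p.1 +i* p.2.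
pose x0 := complex.Re z0; pose y0 := complex.Im z0.
have cf : continuous f.
  move=> p A /nbhs_normc[e e0 HA].
  apply/nbhs_ballP; exists (e / 2) => /=; first by rewrite divr_gt0.
  move=> q [q1 q2]; apply: HA; apply: le_lt_trans (normc_ReIm _) _ => /=.
  move: q1 q2; rewrite /ball /= distrC => q1; rewrite distrC => q2.
  by rewrite [ltRHS]splitr ltrD.
pose B := `[x0 - r, x0 + r]%classic `*` `[y0 - r, y0 + r]%classic.
have cB : compact (f @` B).
  apply: continuous_compact; first exact: continuous_subspaceT.
  by apply: compact_setX; exact: segment_compact.
apply: subclosed_compact cB _ => [|z /= hz].
  rewrite -[X in closed X]setCK; apply: open_closedC; apply/open_normcP.
  move=> z /negP; rewrite -ltNge => hz.
  exists (normc (z - z0) - r); first by rewrite subr_gt0.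
  move=> y hy; apply/negP; rewrite -ltNge.
  have := normc_dist_triangle y z z0; rewrite (normcBC z y); lra.
exists (complex.Re z, complex.Im z); last by case: (z).
have hR := le_trans (Re_normc _) hz; have hI := le_trans (Im_normc _) hz.
split; rewrite /= in_itv /= -ler_distlC distrC /x0 /y0 -raddfB//.
Qed.

(** Argand's argument: in the direction of an [m]-th root of [- c / g z1] the
    term [(z - z1) ^+ m * g z] points against [c = f z1 - w]. *)
Lemma psum_decrease a M z1 w (d : R) : coef_le a M -> normc z1 < 1 ->
  (exists n, a n.+1 != 0) -> psum a z1 != w -> 0 < d ->
  exists z, [/\ normc z < 1, normc (z - z1) < d &
    normc (psum a z - w) < normc (psum a z1 - w)].
Proof.
move=> aM h1 an nw d0; have [k [g [M' [gM g1 E]]]] := psum_local_form aM h1 an.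
pose c := psum a z1 - w; have c0 : c != 0 by rewrite subr_eq0.
have G0 : 0 < normc (psum g z1) by rewrite normc_gt0.
have G20 : 0 < normc (psum g z1) / 2 by rewrite divr_gt0.
have [d' d'0 H] := psum_continuous gM h1 G20.
have [v vE] : exists v, v ^+ k.+1 = - c / psum g z1.
  by exists (k.+1.-root (- c / psum g z1)); rewrite rootCK.
have [t [t0 t1 td td']] :
    exists t : R, [/\ 0 < t, t < 1, t * normc v < d & t * normc v < d'].
  have nv0 := normc_ge0 v; have nv1 : 0 < normc v + 1 by rewrite ltr_wpDl.
  have D0 : 0 < Num.min 1 (Num.min d d' / (normc v + 1)).
    by rewrite lt_min ltr01 divr_gt0// lt_min d0.
  have : Num.min 1 (Num.min d d' / (normc v + 1)) / 2 <
         Num.min 1 (Num.min d d' / (normc v + 1)).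
    by rewrite gtr_pMr ?invf_lt1 ?ltr1n.
  have : 0 < Num.min 1 (Num.min d d' / (normc v + 1)) / 2 by rewrite divr_gt0.
  move: (_ / 2) => t t0.
  rewrite lt_min ltr_pdivlMr// lt_min => /and3P[t1 td td'].
  by exists t; split=> //; lra.
have [z zz] : exists z, z - z1 = t%:C * v.
  by exists (z1 + t%:C * v); rewrite addrC addKr.
have nz : normc (z - z1) = t * normc v.
  by rewrite zz normcM normc_real gtr0_norm.
have [hz hg] : normc z < 1 /\ normc (psum g z - psum g z1) < normc (psum g z1) / 2.
  by apply: H; rewrite nz.
exists z; split=> //; first by rewrite nz.
have s0 : 0 < t ^+ k.+1 by rewrite exprn_gt0.
have s1 : t ^+ k.+1 < 1 by rewrite exprn_ilt1 ?ltW.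
have := E z hz; rewrite zz exprMn vE -rmorphXn /=.
move: (t ^+ k.+1) s0 s1 => s s0 s1 Ez.
have -> : psum a z - w =
    (1 - s : R)%:C * c - s%:C * c * ((psum g z - psum g z1) / psum g z1).
  rewrite Ez rmorphB /= /c; move: (psum g z1) g1 (psum g z) (psum a z1) => u u0.
  by move=> u' v'; field.
apply: le_lt_trans (normc_subD _ _) _; rewrite !normcM normcV !normc_real.
rewrite !gtr0_norm// ?subr_gt0// -/c.
have : normc (psum g z - psum g z1) / normc (psum g z1) < 2^-1.
  by rewrite ltr_pdivrMr// mulrC.
have C0 : 0 < normc c by rewrite normc_gt0.
have := mulr_gt0 s0 C0.
set p := normc (_ - _) / _; set q := normc c; set u := s * q => u0 p2.
have -> : (1 - s) * q = q - u by rewrite /u; ring.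
nra.
Qed.

(** Near [z0], [f - f z0 = (z - z0) ^+ k * g] stays away from zero on a small
    circle.  For [w] close to [f z0] the minimum of [|f - w|] over the closed
    disc is then interior, hence zero. *)
Theorem psum_open_mapping a M (U : set R[i]) : coef_le a M ->
  (exists n, a n.+1 != 0) -> open U -> U `<=` @unit_disk R ->
  open (psum a @` U).
Proof.
move=> aM an /open_normcP oU Ud; apply/open_normcP => _ [z0 Uz0 <-].
have h0 : normc z0 < 1 by rewrite -unit_diskE; exact: Ud.
have [e e0 He] := oU _ Uz0.
have [k [g [M' [gM g1 E]]]] := psum_local_form aM h0 an.
have G20 : 0 < normc (psum g z0) / 2 by rewrite divr_gt0 ?normc_gt0.
have [d d0 Hd] := psum_continuous gM h0 G20.
have [r [r0 re rd]] : exists r : R, [/\ 0 < r, r < e & r < d].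
  have m0 : 0 < Num.min e d by rewrite lt_min e0.
  have : Num.min e d / 2 < Num.min e d by rewrite gtr_pMr ?invf_lt1 ?ltr1n.
  have : 0 < Num.min e d / 2 by rewrite divr_gt0.
  by move: (_ / 2) => r r0; rewrite lt_min => /andP[]; exists r.
have inU z : normc (z - z0) <= r -> U z.
  by move=> hz; apply: He; exact: le_lt_trans re.
have inD z : normc (z - z0) <= r -> normc z < 1.
  by move=> /inU/Ud; rewrite -unit_diskE.
pose del := r ^+ k.+1 * (normc (psum g z0) / 2).
have del0 : 0 < del by rewrite mulr_gt0 ?exprn_gt0.
have circle z : normc (z - z0) = r -> del <= normc (psum a z - psum a z0).
  move=> hz; have hz' := inD z; rewrite hz lexx in hz'.
  rewrite (E z (hz' isT)) addrC addKr normcM normcX hz /del.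
  rewrite ler_wpM2l ?exprn_ge0 ?(ltW r0)//.
  have := (Hd z); rewrite hz => /(_ rd)[_].
  have := normc_leB (psum g z0) (psum g z); rewrite (normcBC (psum g z0)); lra.
exists (del / 2); first by rewrite divr_gt0.
move=> w hw; pose K := [set z : R[i] | normc (z - z0) <= r].
have K0 : K !=set0 by exists z0; rewrite /K /= subrr (@normc0 R) ltW.
have cK : {within K, continuous (fun z => normc (psum a z - w))}.
  apply: continuous_in_subspaceT => z; rewrite inE => Kz.
  apply/(@cvgrPdist_lt _ _ _ (nbhs z)) => e' e'0; apply/nbhs_normc.
  have [d' d'0 H] := psum_continuous aM (inD _ Kz) e'0.
  exists d' => // y /H[_ hy]; apply: le_lt_trans hy.
  rewrite ler_norml; have := normc_dist_triangle (psum a y) (psum a z) w.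
  have := normc_dist_triangle (psum a z) (psum a y) w.
  rewrite (normcBC (psum a z) (psum a y)); lra.
have [z1 + zmin] := compact_EVT_min K0 (@closed_disc_compact z0 r) cK.
rewrite inE /K /= => Kz1.
have {}zmin z : normc (z - z0) <= r ->
    normc (psum a z1 - w) <= normc (psum a z - w).
  by move=> hz; apply: zmin; rewrite inE.
exists z1; first exact: inU.
apply/eqP/negPn/negP => nw.
have z1r : normc (z1 - z0) < r.
  rewrite lt_neqAle Kz1 andbT; apply/eqP => /circle h.
  have := zmin z0; rewrite subrr (@normc0 R) => /(_ (ltW r0)).
  have := normc_dist_triangle w (psum a z1) (psum a z0).
  rewrite (normcBC (psum a z0) w); lra.
have q0 : 0 < r - normc (z1 - z0) by rewrite subr_gt0.
have [z [hz zz1]] := psum_decrease aM (inD _ Kz1) an nw q0.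
rewrite ltNge zmin//; have := normc_dist_triangle z1 z z0; lra.
Qed.

End OpenMapping.

(** * Attaining prescribed values near -1 *)

Section Expansions.
Variable R : realType.
Implicit Types (L S : set R[i]) (x y z p q : R[i]) (c M r : R).

Let Re := @complex.Re R.
Let Im := @complex.Im R.

Let dot x y := Re x * Re y + Im x * Im y.

Lemma sqr_normcE x : normc x ^+ 2 = Re x ^+ 2 + Im x ^+ 2.
Proof. by case: x => a b; rewrite sqr_sqrtr// addr_ge0// sqr_ge0. Qed.

(** Digit expansions in base [z]: the states [S] absorb one digit at a time,
    and the remainder after [n] steps is [z ^+ n] times a state. *)
Lemma psum_expansion L S z M r : normc z < 1 ->
  (forall l, L l -> normc l <= M) -> (forall x, S x -> normc x <= r) ->
  (forall x, S x -> exists l y, [/\ L l, S y & x = l + z * y]) ->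
  forall x, S x -> exists2 a : nat -> R[i], (forall n, L (a n)) & psum a z = x.
Proof.
move=> z1 LM Sr step x Sx.
have /choice[h hP] : forall x, exists p : R[i] * R[i],
    S x -> [/\ L p.1, S p.2 & x = p.1 + z * p.2].
  move=> y; have [Sy|nSy] := pselect (S y); last by exists (0, 0).
  by have [l [y' H]] := step _ Sy; exists (l, y').
pose s n := iter n (fun y => (h y).2) x.
have Ss n : S (s n) by elim: n => [//|n IH] /=; have [] := hP _ IH.
pose a n := (h (s n)).1; have La n : L (a n) by have [] := hP _ (Ss n).
exists a => //; apply: (@psum_unique _ a M r) => // [n|n]; first exact: LM.
have -> : x - psumn a z n = z ^+ n * s n.
  elim: n => [|n IH]; first by rewrite /psumn big_ord0 subr0 mul1r.
  rewrite psumn_recr opprD addrA IH; have [_ _ E] := hP _ (Ss n).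
  by rewrite {1}E /= /a exprSr; ring.
by rewrite normcM normcX mulrC ler_wpM2r ?exprn_ge0 ?normc_ge0// Sr.
Qed.

Lemma proj_collinear (p1 p2 q1 q2 : R) :
  p1 ^+ 2 + p2 ^+ 2 != 0 -> p1 * q2 - p2 * q1 = 0 ->
  (p1 * q1 + p2 * q2) / (p1 ^+ 2 + p2 ^+ 2) * p1 = q1 /\
  (p1 * q1 + p2 * q2) / (p1 ^+ 2 + p2 ^+ 2) * p2 = q2.
Proof.
move=> n0 D0; rewrite ![_ / _ * _]mulrAC; split; apply: (canLR (mulfK n0)).
  have -> : (p1 * q1 + p2 * q2) * p1 =
    q1 * (p1 ^+ 2 + p2 ^+ 2) + p2 * (p1 * q2 - p2 * q1) by ring.
  by rewrite D0 mulr0 addr0.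
have -> : (p1 * q1 + p2 * q2) * p2 =
  q2 * (p1 ^+ 2 + p2 ^+ 2) - p1 * (p1 * q2 - p2 * q1) by ring.
by rewrite D0 mulr0 subr0.
Qed.

Lemma dotxN x y : dot x (- y) = - dot x y.
Proof. by rewrite /dot /Re /Im !raddfN /= !mulrN opprD. Qed.

Lemma sqr_normc_sub x y :
  normc (x - y) ^+ 2 = normc x ^+ 2 - 2 * dot x y + normc y ^+ 2.
Proof. by rewrite !sqr_normcE /dot /Re /Im !raddfB /=; ring. Qed.

(** A planar set that spans no line has, in every direction, a difference of
    two of its points with a definite component: by Cramer's rule [x] is
    controlled by its products with two independent differences [p], [q]. *)
Lemma noncollinear_directions L : (exists x y, [/\ L x, L y & x <> y]) ->
  (~ exists K, real_line K /\ L `<=` K) ->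
  exists2 c, 0 < c & forall x, exists l l',
    [/\ L l, L l' & c * normc x <= dot x (l - l')].
Proof.
move=> [a [b [La Lb ab]]] nl; pose p := b - a.
have p0 : p != 0 by rewrite subr_eq0 eq_sym; exact/eqP.
have pn0 : 0 < normc p by rewrite normc_gt0.
have [d [Ld nd]] : exists d, L d /\ ~ exists t : R, a + t%:C * p = d.
  apply: contrapT => H; apply: nl.
  exists [set a + t%:C * p | t in [set: R]]; split; first by exists a, p.
  move=> x Lx; apply: contrapT => nx; apply: H; exists x; split=> // -[t tx].
  by apply: nx; exists t.
pose q := d - a; pose D := Re p * Im q - Im p * Re q.
have D0 : D != 0.
  apply/eqP => D0; apply: nd; exists (dot p q / normc p ^+ 2).
  have n0 : normc p ^+ 2 != 0 by rewrite expf_neq0// gt_eqF.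
  apply: (addrI (- a)); rewrite addKr [RHS]addrC -/q.
  rewrite sqr_normcE in n0 *.
  have [h1 h2] := proj_collinear n0 D0.
  apply/eqP; rewrite eq_complex /=.
  move: h1 h2; rewrite /dot; case: (p) => p1 p2; case: (q) => q1 q2 /= -> ->.
  by rewrite !mul0r subr0 addr0 !eqxx.
pose A := `|Re q| + `|Im q|; pose B := `|Re p| + `|Im p|.
have A0 : 0 <= A by rewrite addr_ge0.
have B0 : 0 <= B by rewrite addr_ge0.
pose c := `|D| / (A + B + 1).
have AB : 0 < A + B + 1 by rewrite ltr_wpDl// addr_ge0.
exists c; first by rewrite divr_gt0// normr_gt0.
move=> x.
have [hp|hp] := lerP (c * normc x) `|dot x p|.
  have [s|s] := lerP 0 (dot x p); [exists b, a | exists a, b]; split=> //.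
    by rewrite -/p -(ger0_norm s).
  by rewrite -[a - b]opprB -/p dotxN -(ltr0_norm s).
have [hq|hq] := lerP (c * normc x) `|dot x q|.
  have [s|s] := lerP 0 (dot x q); [exists d, a | exists a, d]; split=> //.
    by rewrite -/q -(ger0_norm s).
  by rewrite -[a - d]opprB -/q dotxN -(ltr0_norm s).
exfalso.
have hD : `|D| * normc x <= `|dot x p| * A + `|dot x q| * B.
  apply: le_trans (ler_wpM2l (normr_ge0 D) (normc_ReIm x)) _.
  rewrite mulrDr -!normrM.
  have -> : D * complex.Re x = dot x p * Im q - dot x q * Im p.
    by rewrite /D /dot /Re; ring.
  have -> : D * complex.Im x = dot x q * Re p - dot x p * Re q.
    by rewrite /D /dot /Im; ring.
  apply: le_trans (lerD (ler_normB _ _) (ler_normB _ _)) _.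
  by rewrite !normrM /A /B; lra.
have cE : `|D| * normc x = c * normc x * (A + B + 1).
  by rewrite /c mulrAC divfK// gt_eqF.
have m0 : 0 < c * normc x by exact: le_lt_trans hp.
move: hD; rewrite cE; move: hp hq m0; set m := c * _.
move=> hp hq m0.
have := ler_wpM2r A0 (ltW hp); have := ler_wpM2r B0 (ltW hq); lra.
Qed.

(** One step of the expansion, made two digits at a time so that for [z] near
    [-1] the digits [l], [l'] contribute about the difference [l - l'].  A
    remainder of modulus at least [r / 2] is shortened by [c / 2]; a smaller
    one is left almost unchanged.  The loss from dividing by [z ^+ 2] depends
    on [|z|] only, because discs are invariant under rotations. *)
Lemma two_digit_step L M c r : 0 < c -> 0 <= M ->
  (forall l, L l -> normc l <= M) ->
  (forall x, exists l l', [/\ L l, L l' & c * normc x <= dot x (l - l')]) ->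
  8 * M ^+ 2 / c + c <= r ->
  forall z, normc (z + 1) < c / (4 * r + 2 * M + 2) ->
  forall x, normc x <= r ->
    exists l l' y, [/\ L l, L l', normc y <= r & x = l + z * (l' + z * y)].
Proof.
move=> c0 M0 LM dir hr z zd x xr.
have rc : c <= r by apply: le_trans hr; rewrite lerDr divr_ge0 ?(ltW c0)// mulr_ge0// sqr_ge0.
have hr2 : 8 * M ^+ 2 + c ^+ 2 <= r * c.
  by rewrite -ler_pdivrMr// mulrDl expr2 mulfK// gt_eqF.
have den : 0 < 4 * r + 2 * M + 2 by lra.
move: zd; rewrite ltr_pdivlMr//; set t := normc (z + 1) => zd.
have t0 : 0 <= t by exact: normc_ge0.
have zt : 1 - t <= normc z.
  have := normc_leB 1 (z + 1); rewrite (@normc1 R) -(normc_opp (1 - _)) -/t.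
  by rewrite opprB addrK.
have t14 : t < 4^-1 by nra.
have [l [l' [Ll Ll' h]]] : exists l l', [/\ L l, L l' &
    normc (x - (l - l')) <= r - c / 2].
  have [xs|xb] := lerP (normc x) (r / 2).
    have [l [_ [Ll _ _]]] := dir 0; exists l, l; split=> //.
    by rewrite subrr subr0; lra.
  have [l [l' [Ll Ll' h]]] := dir x; exists l, l'; split=> //.
  have e2 : normc (l - l') <= 2 * M.
    by have := normc_subD l l'; have := LM _ Ll; have := LM _ Ll'; lra.
  (* [|x - e| ^ 2 <= |x| ^ 2 - 2 * c * |x| + 4 * M ^ 2] with [e = l - l'], and
     [c * |x| >= 4 * M ^ 2 + c ^ 2 / 2] by the choice of [r]. *)
  suff : normc (x - (l - l')) <= normc x - c / 2 by lra.
  rewrite -ler_sqr ?nnegrE ?normc_ge0//; last by lra.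
  rewrite sqr_normc_sub; have e0 := normc_ge0 (l - l').
  have : normc (l - l') ^+ 2 <= 4 * M ^+ 2 by nra.
  have := ler_wpM2l (ltW c0) (ltW xb).
  move: h; set u := normc x; set w := dot _ _; nra.
pose y := (x - l - z * l') / z ^+ 2.
have z0 : z != 0 by rewrite -normc_gt0; lra.
exists l, l', y; split=> //; last by rewrite /y; field.
rewrite /y normcM normcV normcX ler_pdivrMr ?exprn_gt0 ?normc_gt0//.
have -> : x - l - z * l' = (x - (l - l')) - (z + 1) * l' by ring.
apply: le_trans (normc_subD _ _) _; rewrite normcM -/t.
have := LM _ Ll'; have := normc_ge0 l'.
move: h; set u := normc (x - _); set w := normc l'; set v := normc z in zt *.
move=> hu w0 wM.
have tw : t * w <= t * M by rewrite ler_wpM2l.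
have v2 : (1 - t) ^+ 2 <= v ^+ 2 by rewrite ler_sqr ?nnegrE; lra.
have r0 : 0 < r by lra.
have := ler_wpM2l (ltW r0) v2; nra.
Qed.

(** A disc is invariant under steps of two digits only, so the states of the
    expansion also comprise the remainders halfway through a step. *)
Theorem psum_attains L M r : (forall l, L l -> normc l <= M) ->
  (exists x y, [/\ L x, L y & x <> y]) ->
  (~ exists K, real_line K /\ L `<=` K) ->
  exists2 d : R, 0 < d & forall z, normc z < 1 -> normc (z + 1) < d ->
    forall x, normc x <= r ->
    exists2 a : nat -> R[i], (forall n, L (a n)) & psum a z = x.
Proof.
move=> LM L2 nl; have [c c0 dir] := noncollinear_directions L2 nl.
have M0 : 0 <= M.
  by have [l [y [/LM h _ _]]] := L2; exact: le_trans (normc_ge0 l) h.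
have [r' rr' r'c] : exists2 r', r <= r' & 8 * M ^+ 2 / c + c <= r'.
  by exists (Num.max r (8 * M ^+ 2 / c + c)); rewrite le_max lexx ?orbT.
have r'0 : 0 <= r'.
  by apply: le_trans r'c; rewrite addr_ge0 ?divr_ge0 ?(ltW c0)// mulr_ge0// sqr_ge0.
exists (c / (4 * r' + 2 * M + 2)); first by rewrite divr_gt0//; lra.
move=> z z1 zd x xr.
pose S y := normc y <= r' \/
  exists l w, [/\ L l, normc w <= r' & y = l + z * w].
apply: (@psum_expansion L S z M (M + r')) => //.
- move=> y [yr|[l [w [Ll wr ->]]]]; first by rewrite ler_wpDl.
  apply: le_trans (normc_leD _ _) _; rewrite lerD ?LM// normcM.
  by apply: le_trans wr; rewrite ler_piMl ?normc_ge0// ltW.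
- move=> y [yr|[l [w [Ll wr ->]]]]; last first.
    by exists l, w; split=> //; left.
  have [l [l' [w [Ll Ll' wr ->]]]] := two_digit_step c0 M0 LM dir r'c zd yr.
  by exists l, (l' + z * w); split=> //; right; exists l', w.
by left; exact: le_trans rr'.
Qed.

End Expansions.

(** * Baire category *)

Section Genericity.
Variable T : topologicalType.
Implicit Types (A : set T) (P Q : T -> Prop).

Lemma nowhere_denseS A (B : set T) :
  A `<=` B -> nowhere_dense B -> nowhere_dense A.
Proof.
move=> AB; rewrite /nowhere_dense => B0.
by rewrite -subset0 -B0; exact/interiorS/closureS.
Qed.

Lemma nowhere_denseC A : open A -> dense A -> nowhere_dense (~` A).
Proof.
move=> oA dA; rewrite /nowhere_dense.
have /closure_id <- : closed (~` A) by exact: open_closedC.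
apply/eqP/negPn/negP => /set0P nI.
by have [x [/interior_subset]] := dA _ nI (open_interior _).
Qed.

Lemma generically_sub P Q : (forall x, P x -> Q x) ->
  generically P -> generically Q.
Proof.
move=> PQ [F nF FE]; exists (fun n => F n `&` ~` [set x | Q x]).
  by move=> n; apply: nowhere_denseS (nF n); exact: subIsetl.
apply/seteqP; split=> [x nQ|x [n _ []//]].
have : (~` [set x | P x]) x by move=> /PQ.
by rewrite FE => -[n _ Fx]; exists n.
Qed.

Lemma generically_forall (I : countType) (P : I -> T -> Prop) :
  (forall i, open [set x | P i x]) -> (forall i, dense [set x | P i x]) ->
  generically (fun x => forall i, P i x).
Proof.
move=> oP dP.
exists (fun n => if unpickle n is Some i then ~` [set x | P i x] else set0).
  move=> n; case: unpickle => [i|]; first exact: nowhere_denseC.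
  by rewrite /nowhere_dense closure0 interior0.
apply/seteqP; split=> [x /existsNP[i nP]|x [n _]].
  by exists (pickle i) => //; rewrite pickleK.
by case: unpickle => // i nP H; exact: nP (H i).
Qed.

End Genericity.

(** * The space of coefficient sequences *)

Section CoefficientSpace.
Variables (R : realType) (L : set R[i]).
Implicit Types (lam mu : Omega L) (z w : R[i]) (U : set R[i]).

Definition coef lam : nat -> R[i] := fun n => set_val (lam n).

Lemma power_seriesE lam z : power_series lam z = psum (coef lam) z.
Proof. by rewrite psum.unlock. Qed.

Lemma coef_in lam n : L (coef lam n).
Proof. by rewrite /coef; exact: set_valP. Qed.

Lemma coef_surj (a : nat -> R[i]) : (forall n, L (a n)) ->
  exists lam, coef lam = a.
Proof.
move=> La; have /choice[lam lamE] : forall n, exists l : L, set_val l = a n.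
  by move=> n; exists (exist _ (a n) (mem_set (La n))).
by exists lam; apply/funext.
Qed.

Lemma coef_continuous n : continuous (coef ^~ n : Omega L -> R[i]).
Proof.
move=> lam; apply: (@continuous_comp _ _ _ (fun mu : Omega L => mu n) set_val).
  exact: (@proj_continuous nat (fun _ => L : topologicalType) n lam).
exact: initial_continuous.
Qed.

(** Neighbourhoods in the product contain cylinders: otherwise points outside
    agreeing with [lam] on longer and longer prefixes converge to [lam]. *)
Lemma nbhs_cylinder lam (O : set (Omega L)) : nbhs lam O ->
  exists N, forall mu, (forall n, (n < N)%N -> mu n = lam n) -> O mu.
Proof.
move=> nO; apply: contrapT => /forallNP H.
have /choice[s sP] : forall N, exists mu : Omega L,
    (forall n, (n < N)%N -> mu n = lam n) /\ ~ O mu.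
  move=> N; have /existsNP[mu /not_implyP[h1 h2]] := H N.
  by exists mu.
have : s @ \oo --> lam.
  apply/cvg_sup => i A [B [oB Blam BA]].
  exists i.+1 => // N /= iN; apply: BA.
  case: oB Blam => B' oB' <- /=.
  by rewrite (sP N).1.
move=> /(_ _ nO)[N _ HN]; exact: (sP N).2 (HN N (leqnn N)).
Qed.

End CoefficientSpace.

(** * Generic coefficients off a line *)

Section GenericValues.
Variables (R : realType) (L : set R[i]) (M : R).
Hypothesis LM : forall l, L l -> normc l <= M.
Implicit Types (lam mu : Omega L) (z w : R[i]) (U : set R[i]).

Lemma coefM lam : coef_le (coef lam) M.
Proof. by move=> n; apply: LM; exact: coef_in. Qed.

(** At a fixed point of the disc the tails are uniformly small, so only
    finitely many coefficients matter. *)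
Lemma psum_coef_continuous lam z (e : R) : normc z < 1 -> 0 < e ->
  \forall mu \near lam, normc (psum (coef mu) z - psum (coef lam) z) < e.
Proof.
move=> z1 e0; pose C := M / (1 - normc z).
have CN mu N : normc (psum (shift N (coef mu)) z) <= C.
  exact: psum_le (coef_le_shift N (coefM mu)) z1.
have [N hN] : exists N, 2 * C * normc z ^+ N < e / 2.
  apply: contrapT => /forallNP H.
  have := le0_geometric (normc_ge0 z) z1 (x := e / 2) (C := 2 * C).
  move=> /(_ (fun N => _)) h; have : e / 2 <= 0.
    by apply: h => N; rewrite leNgt; exact/negP/H.
  by rewrite leNgt divr_gt0.
have e'0 : 0 < e / 2 / N.+1%:R by rewrite !divr_gt0// ltr0n.
have : \forall mu \near lam, forall n : 'I_N,
    normc (coef mu n - coef lam n) < e / 2 / N.+1%:R.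
  apply: (@filter_forall _ 'I_N (fun n => [set mu : Omega L |
    normc (coef mu n - coef lam n) < e / 2 / N.+1%:R]) (nbhs lam)) => n.
  have := @coef_continuous R L n lam
    [set y | normc (y - coef lam n) < e / 2 / N.+1%:R].
  by apply; apply/nbhs_normc; exists (e / 2 / N.+1%:R).
apply: filterS => mu H.
rewrite (psum_shift N (coefM mu) z1) (psum_shift N (coefM lam) z1).
set p := psumn _ _ _; set q := psumn _ _ _; set u := psum _ _; set v := psum _ _.
have -> : p + z ^+ N * u - (q + z ^+ N * v) = (p - q) + z ^+ N * (u - v) by ring.
apply: le_lt_trans (normc_leD _ _) _.
have pq : normc (p - q) <= e / 2.
  rewrite /p /q /psumn -sumrB.
  apply: le_trans (normc_sum _) _.
  apply: le_trans (_ : _ <= \sum_(n < N) (e / 2 / N.+1%:R)) _.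
    apply: ler_sum => n _; rewrite -mulrBl normcM normcX.
    apply: le_trans (ltW (H n)).
    by rewrite ler_piMr ?normc_ge0// exprn_ile1 ?normc_ge0// ltW.
  rewrite sumr_const card_ord -[leLHS]mulr_natr -mulrA ler_piMr ?divr_ge0 ?(ltW e0)//.
  by rewrite mulrC ler_pdivrMr ?ltr0n// mul1r ler_nat.
have uv : normc (u - v) <= 2 * C.
  by have := normc_subD u v; have := CN mu N; have := CN lam N; rewrite -/u -/v; lra.
rewrite normcM normcX.
have := ler_wpM2l (exprn_ge0 N (normc_ge0 z)) uv; move: hN.
set x := _ ^+ N; lra.
Qed.

Lemma open_hits U w (e : R) : U `<=` @unit_disk R ->
  open [set lam : Omega L | exists2 z, U z & normc (psum (coef lam) z - w) < e].
Proof.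
move=> UD; rewrite openE => lam [z Uz h]; rewrite /interior /=.
have z1 : normc z < 1 by rewrite -unit_diskE; exact: UD.
have e0 : 0 < e - normc (psum (coef lam) z - w) by rewrite subr_gt0.
apply: filterS (psum_coef_continuous lam z1 e0) => mu hmu.
exists z => //; apply: le_lt_trans (normc_dist_triangle (psum (coef lam) z) _ _) _.
lra.
Qed.

(** Prescribing the first [N] coefficients turns [w] into the target
    [(w - prefix) / z ^ N] for the others.  Where [|z| >= 1 / 2] its modulus is
    at most the [r] below, whatever [z], so [psum_attains] provides them as
    soon as [z] is close enough to [-1]. *)
Lemma dense_attains U w :
  (exists x y, [/\ L x, L y & x <> y]) ->
  (~ exists K, real_line K /\ L `<=` K) ->
  U `<=` @unit_disk R -> closure U (-1) ->
  dense [set lam : Omega L | exists2 z, U z & psum (coef lam) z = w].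
Proof.
move=> L2 nl UD /closure_normcP cU O [lam Olam] oO.
have [N HN] : exists N, forall mu, (forall n, (n < N)%N -> mu n = lam n) -> O mu.
  by apply: nbhs_cylinder; exact: open_nbhs_nbhs.
pose r := (normc w + N%:R * M) * 2 ^+ N.
have [d d0 H] := psum_attains r LM L2 nl.
have [z Uz] : exists2 z, U z & normc (z - (-1)) < Num.min d 2^-1.
  by apply: cU; rewrite lt_min d0 invr_gt0 ltr0n.
rewrite opprK lt_min => /andP[zd zh].
have z1 : normc z < 1 by rewrite -unit_diskE; exact: UD.
have z2 : 2^-1 <= normc z.
  have := normc_leB 1 (z + 1); rewrite (@normc1 R) -(normc_opp (1 - _)).
  by rewrite opprB addrK; lra.
have z0 : z != 0 by rewrite -normc_gt0; lra.
pose x := (w - psumn (coef lam) z N) / z ^+ N.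
have [|a La ax] := H z z1 zd x.
  rewrite /x normcM normcV normcX ler_pdivrMr ?exprn_gt0 ?normc_gt0//.
  have pN : normc (psumn (coef lam) z N) <= N%:R * M.
    apply: le_trans (normc_sum _) _.
    rewrite mulr_natl -[N in leRHS](card_ord N) -sumr_const; apply: ler_sum => n _.
    rewrite normcM normcX; apply: le_trans (coefM lam n).
    by rewrite ler_piMr ?normc_ge0// exprn_ile1 ?normc_ge0// ltW.
  apply: le_trans (normc_subD _ _) _.
  apply: le_trans (lerD (lexx _) pN) _.
  have nM : 0 <= normc w + N%:R * M.
    by apply: le_trans (lerD (lexx _) pN); rewrite addr_ge0 ?normc_ge0.
  rewrite /r -mulrA -exprMn ler_peMr// exprn_ege1//.
  by rewrite -ler_pdivrMl ?ltr0n// mulr1.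
have [mu muE] : exists mu : Omega L, coef mu = a by exact: coef_surj.
exists (fun n => if (n < N)%N then lam n else mu (n - N)%N); split.
  by apply: HN => n ->.
exists z => //; set nu := (X in coef X).
rewrite (psum_shift N (coefM nu) z1).
have -> : psumn (coef nu) z N = psumn (coef lam) z N.
  by apply: eq_bigr => n _; rewrite /coef /nu ltn_ord.
have -> : shift N (coef nu) = a.
  apply/funext => n; rewrite -muE /shift /coef /nu.
  by rewrite ltnNge leq_addr /= addKn.
by rewrite ax /x mulrC divfK ?expf_neq0// addrC subrK.
Qed.

(** The discs with centre in the grid of mesh [1 / k] and radius [1 / k], for
    all [k], form the countable family to which [generically_forall]
    applies. *)
Lemma generically_dense U :
  (exists x y, [/\ L x, L y & x <> y]) ->
  (~ exists K, real_line K /\ L `<=` K) ->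
  U `<=` @unit_disk R -> closure U (-1) ->
  generically (fun lam : Omega L => dense (psum (coef lam) @` U)).
Proof.
move=> L2 nl UD cU.
pose ctr (i : nat * int * int) : R[i] :=
  (i.1.2%:~R / i.1.1.+1%:R) +i* (i.2%:~R / i.1.1.+1%:R).
apply: (@generically_sub _ (fun lam : Omega L => forall i : nat * int * int,
    exists2 z, U z & normc (psum (coef lam) z - ctr i) < i.1.1.+1%:R^-1)).
  move=> lam H O [w Ow] /open_normcP/(_ _ Ow)[e e0 He].
  pose k := Num.trunc (3 / e).
  have k0 : 0 < (k.+1%:R : R) by rewrite ltr0n.
  have hk : 3 * k.+1%:R^-1 < e.
    rewrite -ltr_pdivlMr ?invr_gt0// invrK mulrC -ltr_pdivrMr//.
    exact: truncnS_gt.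
  have approx (t : R) : exists p : int, `|t - p%:~R / k.+1%:R| <= k.+1%:R^-1.
    exists (Num.floor (t * k.+1%:R)).
    have -> : t - (Num.floor (t * k.+1%:R))%:~R / k.+1%:R =
        (t * k.+1%:R - (Num.floor (t * k.+1%:R))%:~R) / k.+1%:R.
      by rewrite mulrBl mulfK// gt_eqF.
    rewrite normrM [X in _ * X]ger0_norm ?invr_ge0//.
    rewrite ler_piMl ?invr_ge0// ger0_norm ?subr_ge0 ?floor_le//.
    by rewrite lerBlDl; have := floorD1_gt (t * k.+1%:R); rewrite intrD => /ltW.
  have [p hp] := approx (complex.Re w); have [q hq] := approx (complex.Im w).
  have [z Uz hz] := H (k, p, q).
  exists (psum (coef lam) z); split; last by exists z.
  apply: He; apply: le_lt_trans (normc_dist_triangle (ctr (k, p, q)) _ _) _.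
  have : normc (ctr (k, p, q) - w) <= 2 * k.+1%:R^-1.
    rewrite normcBC; apply: le_trans (normc_ReIm _) _.
    by rewrite !raddfB mulr_natl mulr2n; exact: lerD hp hq.
  move=> h2; apply: lt_trans hk.
  have -> : 3 * k.+1%:R^-1 = k.+1%:R^-1 + 2 * k.+1%:R^-1 :> R by ring.
  exact: ltr_leD hz h2.
apply: generically_forall => i; first exact: open_hits.
move=> O O0 oO; have [lam [Olam [z Uz hz]]] := dense_attains (ctr i) L2 nl UD cU O0 oO.
exists lam; split=> //; exists z => //.
by rewrite hz subrr (@normc0 R) invr_gt0 ltr0n.
Qed.

(** A dense image rules out constants, so density already brings openness. *)
Lemma dense_image_open U lam : open U -> U `<=` @unit_disk R ->
  dense (psum (coef lam) @` U) -> open (psum (coef lam) @` U).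
Proof.
move=> oU UD dU; apply: (psum_open_mapping (coefM lam)) => //.
apply: contrapT => /forallNP H.
have c0 : coef_le (shift 1 (coef lam)) 0.
  by move=> n; have /negP/negPn/eqP := H n; rewrite /shift add1n => ->; rewrite (@normc0 R).
have cst z : normc z < 1 -> psum (coef lam) z = coef lam 0.
  move=> z1; rewrite (psum_recl (coefM lam) z1).
  suff -> : psum (shift 1 (coef lam)) z = 0 by rewrite mulr0 addr0.
  apply/eqP; rewrite -normc_eq0 eq_le normc_ge0 andbT.
  by have := psum_le c0 z1; rewrite mul0r.
have oO : open [set w : R[i] | w != coef lam 0].
  apply/open_normcP => w /= hw; exists (normc (w - coef lam 0)).
    by rewrite normc_gt0 subr_eq0.
  by move=> y hy; apply/eqP => yE; move: hy; rewrite yE normcBC ltxx.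
have O0 : [set w : R[i] | w != coef lam 0] !=set0.
  by exists (coef lam 0 + 1); rewrite /= -subr_eq0 addrAC subrr add0r oner_neq0.
have [w [/eqP nw [z Uz zw]]] := dU _ O0 oO.
by apply: nw; rewrite -zw cst// -unit_diskE; exact: UD.
Qed.

End GenericValues.

(** * Coefficients on a line *)

Section Collinear.
Variable R : realType.
Implicit Types (a : nat -> R[i]) (z w b : R[i]).

Lemma sum_geometric_le1 (r : R) N : 0 <= r -> r < 1 ->
  (1 - r) * \sum_(n < N) r ^+ n <= 1.
Proof.
move=> r0 r1; rewrite -opprB mulNr -subrX1 opprB.
by rewrite gerBl exprn_ge0.
Qed.

Lemma normc_sum_geometric z N : normc z < 1 -> complex.Re z <= 0 ->
  normc (\sum_(n < N) z ^+ n) <= 2.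
Proof.
move=> z1 zR; have h : 1 <= normc (z - 1).
  apply: le_trans (Re_normc _); rewrite raddfB ler0_norm; last first.
    by rewrite subr_le0 (le_trans zR) // ler01.
  by rewrite opprB lerDl oppr_ge0.
have s0 := normc_ge0 (\sum_(n < N) z ^+ n).
apply: (le_trans (ler_peMl s0 h)).
rewrite -normcM -subrX1; apply: le_trans (normc_subD _ _) _.
rewrite (@normc1 R) normcX.
by rewrite -[leRHS]/(1 + 1) lerD2r exprn_ile1 ?normc_ge0// ltW.
Qed.

Lemma Im_exprS z n : `|complex.Im (z ^+ n.+1)| <=
  normc z * `|complex.Im (z ^+ n)| + `|complex.Im z| * normc z ^+ n.
Proof.
rewrite exprS -normcX; set w := z ^+ n.
have -> : complex.Im (z * w) =
    complex.Re z * complex.Im w + complex.Im z * complex.Re w.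
  by case: (z); case: (w) => ? ? ? ? /=; ring.
apply: le_trans (ler_normD _ _) _; rewrite !normrM lerD//.
  by rewrite ler_wpM2r// Re_normc.
by rewrite ler_wpM2l// Re_normc.
Qed.

(** In the region [|Im z| <= (1 - |z|) ^ 2], tangent to the real axis at
    [-1], the powers of [z] are summably close to the reals. *)
Lemma sum_Im_expr z N : normc z < 1 ->
  `|complex.Im z| <= (1 - normc z) ^+ 2 ->
  \sum_(n < N) `|complex.Im (z ^+ n)| <= 1.
Proof.
move=> z1 hI; have r0 := normc_ge0 z.
elim: N => [|N IH]; first by rewrite big_ord0.
rewrite big_ord_recl expr0 /= normr0 add0r.
apply: le_trans (ler_sum _ (fun (i : 'I_N) _ => Im_exprS z i)) _.
rewrite big_split -!mulr_sumr.
have g0 : 0 <= \sum_(n < N) normc z ^+ n.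
  by apply: sumr_ge0 => n _; rewrite exprn_ge0.
have := ler_wpM2r g0 hI; have := ler_wpM2l r0 IH.
have := sum_geometric_le1 N r0 z1.
set G := \sum_(n < N) _ ^+ n; set W := \sum_(n < N) `|_|.
set r := normc z in r0 z1 *; set v := `|complex.Im z|.
move=> hG hW hv; have r1 : 0 <= 1 - r by rewrite subr_ge0 ltW.
have := ler_wpM2l r1 hG; rewrite [_ + _]/GRing.add /=; nra.
Qed.

(** Dividing the partial sums by [b] leaves [p / b] times a geometric sum,
    bounded because [z] stays away from [1], and a sum with real
    coefficients. *)
Lemma Im_psum_collinear a M p b (T : R) z : coef_le a M -> b != 0 ->
  (forall n, exists2 t : R, `|t| <= T & a n = p + t%:C * b) ->
  normc z < 1 -> complex.Re z <= 0 ->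
  `|complex.Im z| <= (1 - normc z) ^+ 2 ->
  complex.Im (psum a z / b) <= 2 * normc (p / b) + T.
Proof.
move=> aM b0 at_ z1 zR zI.
have bn0 : 0 < normc b by rewrite normc_gt0.
have T0 : 0 <= T by have [t tT _] := at_ 0; exact: le_trans tT.
have part N : complex.Im (psumn a z N / b) <= 2 * normc (p / b) + T.
  have /choice[t tE] : forall n, exists t : R, `|t| <= T /\ a n = p + t%:C * b.
    by move=> n; have [t ? ?] := at_ n; exists t.
  have -> : psumn a z N / b =
      (p / b) * (\sum_(n < N) z ^+ n) + \sum_(n < N) (t n)%:C * z ^+ n.
    rewrite /psumn mulr_suml mulr_sumr -big_split; apply: eq_bigr => n _.
    by rewrite (tE n).2 /=; field.
  rewrite raddfD; apply: lerD.
    apply: le_trans (ler_norm _) _; apply: le_trans (Im_normc _) _.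
    by rewrite normcM mulrC ler_wpM2r ?normc_ge0// normc_sum_geometric.
  rewrite raddf_sum; apply: le_trans (ler_norm _) _.
  apply: le_trans (ler_norm_sum _ _ _) _.
  apply: le_trans (_ : _ <= \sum_(n < N) T * `|complex.Im (z ^+ n)|) _.
    apply: ler_sum => n _; rewrite -[leLHS]/(`|complex.Im ((t n)%:C * z ^+ n)|).
    have -> : complex.Im ((t n)%:C * z ^+ n) = t n * complex.Im (z ^+ n).
      by case: (z ^+ n) => ? ? /=; ring.
    by rewrite normrM ler_wpM2r// (tE n).1.
  by rewrite -mulr_sumr ler_piMr// sum_Im_expr.
apply/ler_addgt0Pl => e e0.
have [N /(_ N (leqnn _)) /ltW h] := psum_cvg aM z1 (mulr_gt0 e0 bn0).
have := part N; set u := psum a z; set v := psumn a z N.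
have : complex.Im (u / b) - complex.Im (v / b) <= e.
  rewrite -raddfB -mulrBl; apply: le_trans (ler_norm _) _.
  apply: le_trans (Im_normc _) _.
  by rewrite normcM normcV ler_pdivrMr// normcBC.
lra.
Qed.

(** Balls centred on the real axis whose radii shrink quadratically towards
    [-1]: a union of balls is open at once, and it lies in the region of
    [sum_Im_expr]. *)
Definition cusp : set R[i] :=
  [set z | exists2 s : R, 0 < s < 2^-1 & normc (z - (s - 1 : R)%:C) < s ^+ 2 / 4].

Lemma open_cusp : open cusp.
Proof.
apply/open_normcP => z [s s01 h].
exists (s ^+ 2 / 4 - normc (z - (s - 1 : R)%:C)); first by rewrite subr_gt0.
move=> y hy; exists s => //.
apply: le_lt_trans (normc_dist_triangle z _ _) _; lra.
Qed.

Lemma closure_cusp : closure cusp (-1).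
Proof.
apply/closure_normcP => e e0; pose s := Num.min e 2^-1 / 2.
have m0 : 0 < Num.min e 2^-1 by rewrite lt_min e0 invr_gt0 ltr0n.
have s0 : 0 < s by rewrite divr_gt0.
have : s < Num.min e 2^-1 by rewrite gtr_pMr ?invf_lt1 ?ltr1n.
rewrite lt_min => /andP[se s2].
exists (s - 1 : R)%:C; last first.
  by rewrite rmorphB rmorph1 opprK subrK normc_real gtr0_norm.
exists s; first by rewrite s0.
by rewrite subrr (@normc0 R) divr_gt0 ?exprn_gt0.
Qed.

Lemma cusp_bounds z : cusp z -> [/\ normc z < 1, complex.Re z <= 0 &
  `|complex.Im z| <= (1 - normc z) ^+ 2].
Proof.
move=> [s /andP[s0 s2] h]; set c := (s - 1 : R)%:C in h *.
have nc : normc c = 1 - s by rewrite normc_real distrC ger0_norm//; lra.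
have hz := normc_leB z c; rewrite nc in hz.
have hR := Re_normc (z - c); have hI := Im_normc (z - c).
rewrite raddfB /= in hR; rewrite raddfB /= subr0 in hI.
have s22 : s ^+ 2 <= s / 2 by rewrite expr2; nra.
have b1 : 3 / 4 * s <= 1 - normc z by lra.
split; first by lra.
  have := ler_norm (complex.Re z - (s - 1)); lra.
apply: (le_trans hI); apply: ltW; apply: lt_le_trans h _.
by nra.
Qed.

(** The component lies beyond [S] because its image under
    [w |-> Im (w / b)] is an interval that misses [S].  The margin [1] spares
    the exact determination of the closure: its points are within [|b|] of
    the component. *)
Lemma half_plane_beyond b (S : R) : b != 0 -> exists2 H : set R[i],
  closed_real_half_plane H & forall w, H w -> S - 1 < complex.Im (w / b).
Proof.
move=> b0; have bn0 : 0 < normc b by rewrite normc_gt0.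
pose phi w := complex.Im (w / b).
pose K : set R[i] := [set (0 +i* S) * b + t%:C * b | t in [set: R]].
pose z0 : R[i] := (0 +i* (S + 1)) * b.
have phiz0 : phi z0 = S + 1 by rewrite /phi /z0 mulfK.
have nK w : phi w = S -> K w.
  move=> hw; exists (complex.Re (w / b)) => //.
  rewrite -mulrDl -[RHS](divfK b0); congr (_ * _); rewrite -hw /phi.
  by case: (w / b) => x y /=; apply/eqP; rewrite eq_complex /= !add0r addr0 !eqxx.
have Kphi w : K w -> phi w = S.
  by move=> [t _ <-]; rewrite /phi -mulrDl mulfK //= addr0.
have nz0 : (~` K) z0 by move=> /Kphi; rewrite phiz0; lra.
pose P := connected_component (~` K) z0.
have lip w y : `|phi w - phi y| <= normc (w - y) / normc b.
  by rewrite /phi -raddfB -mulrBl -normcV -normcM Im_normc.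
have cphi : continuous phi.
  move=> w; apply/(@cvgrPdist_lt _ _ _ (nbhs w)) => e e0; apply/nbhs_normc.
  exists (e * normc b) => [|y hy]; first by rewrite mulr_gt0.
  by apply: le_lt_trans (lip _ _) _; rewrite ltr_pdivrMr// normcBC.
have PS w : P w -> S < phi w.
  move=> Pw; rewrite ltNge; apply/negP => hw.
  have cI : connected (phi @` P).
    apply: connected_continuous_connected; first exact: component_connected.
    exact: continuous_subspaceT.
  have /connected_intervalP iI := cI.
  have [|||w' Pw' hw'] := iI (phi w) (phi z0) _ _ S.
  - by exists w.
  - by exists z0 => //; exact: connected_component_refl.
  - by rewrite hw phiz0 lerDl ler01.
  have := @connected_component_sub _ (~` K) z0 w' Pw'.
  by move=> /(_ (nK _ hw')).
exists (closure P); first by exists P => //; exists K, z0; split=> //; exists ((0 +i* S) * b), b.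
move=> w /closure_normcP/(_ _ bn0)[y /PS Py hy].
have := lip y w; have : normc (y - w) / normc b < 1 by rewrite ltr_pdivrMr// mul1r.
have := ler_norm (phi y - phi w); rewrite -/(phi w); lra.
Qed.

End Collinear.

(** * The dichotomy *)

Section Dichotomy.
Variables (R : realType) (L : set R[i]) (M : R).
Hypothesis LM : forall l, L l -> normc l <= M.

Theorem generic_image_dense_open (U : set R[i]) :
  (exists x y, [/\ L x, L y & x <> y]) ->
  (~ exists K, real_line K /\ L `<=` K) ->
  open U -> U `<=` @unit_disk R -> closure U (-1) ->
  generically (fun lam : Omega L =>
    dense (power_series lam @` U) /\ open (power_series lam @` U)).
Proof.
move=> L2 nl oU UD cU; have := generically_dense LM L2 nl UD cU.
apply: generically_sub => lam.
have -> : power_series lam = psum (coef lam).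
  by apply/funext => z; exact: power_seriesE.
by move=> dU; split=> //; exact: (dense_image_open LM).
Qed.

Theorem collinear_image_avoids_half_plane :
  (exists K, real_line K /\ L `<=` K) ->
  exists U H : set R[i],
    [/\ open U, U `<=` @unit_disk R, closure U (-1),
        closed_real_half_plane H &
        forall lam : Omega L, (power_series lam @` U) `&` H = set0].
Proof.
move=> [_ [[p [b [b0 ->]]] Lpb]].
have bn0 : 0 < normc b by rewrite normc_gt0.
pose T := (M + normc p) / normc b.
have [H hH HP] := half_plane_beyond (2 * normc (p / b) + T + 1) b0.
exists (@cusp R), H; split=> //.
- exact: open_cusp.
- by move=> z /cusp_bounds[z1 _ _]; rewrite unit_diskE.
- exact: closure_cusp.
move=> lam; rewrite -subset0 => _ [[z Uz <-] /HP].
have [z1 zR zI] := cusp_bounds Uz.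
rewrite power_seriesE addrK ltNge => /negP; apply.
apply: (@Im_psum_collinear _ _ M) => // n; first by apply: LM; exact: coef_in.
have [t _ tE] := Lpb _ (coef_in lam n); exists t => //.
rewrite /T ler_pdivlMr// -normc_real -normcM -[_ * b](addKr p) addrC tE.
by apply: le_trans (normc_subD _ _) _; rewrite lerD2r LM//; exact: coef_in.
Qed.

End Dichotomy.

Unset Implicit Arguments.

Theorem theorem2 (R : realType) (Lambda : set R[i])
    (Lambda_bounded : bounded_set Lambda)
    (Lambda_two : exists x y : R[i], [/\ Lambda x, Lambda y & x <> y])
    (Omega_baire : baire_space (Omega Lambda)) :
  ((~ exists L : set R[i], real_line L /\ Lambda `<=` L) ->
   forall U : set R[i], open U -> U `<=` @unit_disk R -> closure U (-1) ->
   generically (fun lambda : Omega Lambda =>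
     dense (power_series lambda @` U) /\ open (power_series lambda @` U)))
  /\
  ((exists L : set R[i], real_line L /\ Lambda `<=` L) ->
   exists U H : set R[i],
     [/\ open U, U `<=` @unit_disk R, closure U (-1),
         closed_real_half_plane H &
         forall lambda : Omega Lambda,
           (power_series lambda @` U) `&` H = set0]).
Proof.
have [M _ LM] := bounded_setC Lambda_bounded.
split; last exact: (collinear_image_avoids_half_plane LM).
by move=> nl U; exact: (generic_image_dense_open LM Lambda_two nl).
Qed.
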